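(* Let $\mathcal{X}$ be a finite set with $|\mathcal{X}|\geq 2$. Then $(\mathrm{DMC}_{\mathcal{X},\ast}^{(o)},\mathcal{T}_{TV,\mathcal{X},\ast}^{(o)})$, where $\mathcal{T}_{TV,\mathcal{X},\ast}^{(o)}$ is the total-variation topology, is not a Baire space, and it is not locally compact anywhere (i.e., no point of it has a compact neighborhood).
   Context: For finite nonempty sets $\mathcal{X},\mathcal{Y}$, $\mathrm{DMC}_{\mathcal{X},\mathcal{Y}}$ is the set of channels from $\mathcal{X}$ to $\mathcal{Y}$, i.e. functions $W:\mathcal{X}\times\mathcal{Y}\to[0,1]$, written $W(y|x)$, with $\sum_{y\in\mathcal{Y}}W(y|x)=1$ for every $x\in\mathcal{X}$. For $W\in\mathrm{DMC}_{\mathcal{X},\mathcal{Y}}$ and $V\in\mathrm{DMC}_{\mathcal{Y},\mathcal{Z}}$, $V\circ W\in\mathrm{DMC}_{\mathcal{X},\mathcal{Z}}$ is $(V\circ W)(z|x)=\sum_{y\in\mathcal{Y}}V(z|y)W(y|x)$. A channel $W'\in\mathrm{DMC}_{\mathcal{X},\mathcal{Z}}$ is degraded from $W\in\mathrm{DMC}_{\mathcal{X},\mathcal{Y}}$ if $W'=V\circ W$ for some $V\in\mathrm{DMC}_{\mathcal{Y},\mathcal{Z}}$; $W$ and $W'$ are equivalent if each is degraded from the other. Let $[n]=\{1,\dots,n\}$, $\mathrm{DMC}_{\mathcal{X},\ast}=\coprod_{n\ge1}\mathrm{DMC}_{\mathcal{X},[n]}$, and let $\mathrm{DMC}_{\mathcal{X},\ast}^{(o)}$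 be the quotient set of $\mathrm{DMC}_{\mathcal{X},\ast}$ by equivalence of channels. Let $\Delta_{\mathcal{X}}$ be the simplex of probability distributions on $\mathcal{X}$. For $W\in\mathrm{DMC}_{\mathcal{X},\mathcal{Y}}$, put $P_W^o(y)=\frac1{|\mathcal{X}|}\sum_{x}W(y|x)$, $\mathrm{Im}(W)=\{y:P_W^o(y)>0\}$, and for $y\in\mathrm{Im}(W)$ let $W_y^{-1}\in\Delta_{\mathcal{X}}$ be $W_y^{-1}(x)=W(y|x)/(|\mathcal{X}|P_W^o(y))$. The Blackwell measure of $W$ is the Borel probability measure $\mathrm{MP}_W=\sum_{y\in\mathrm{Im}(W)}P_W^o(y)\,\delta_{W_y^{-1}}$ on $\Delta_{\mathcal{X}}$. It is known that two channels with input alphabet $\mathcal{X}$ are equivalent if and only if they have the same Blackwell measure, so $\mathrm{MP}_{\hat W}$ is defined for $\hat W\in\mathrm{DMC}_{\mathcal{X},\ast}^{(o)}$ and determines $\hat W$; it is also known that the Blackwell measures are exactly the finitely supported Borel probability measures $M$ on $\Delta_{\mathcal{X}}$ for which $\int p\,dM(p)$ is the uniform distribution on $\mathcal{X}$. The total-variation topology $\mathcal{T}_{TV,\mathcal{X},\ast}^{(o)}$ is induced by the metric $d_{TV,\mathcal{X},\ast}^{(o)}(\hat W,\hat W')=\|\mathrm{MP}_{\hat W}-\mathrm{MP}_{\hat W'}\|_{TV}=\sup_{B}|\mathrm{MP}_{\hat W}(B)-\mathrm{MP}_{\hat W'}(B)|$, the supremum being over Borel sets $B\subset\Delta_{\mathcal{X}}$.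 A Baire space is a topological space in which every countable intersection of dense open subsets is dense. *)

(* Defs.v *)
From HB Require Import structures.
From mathcomp Require Import all_boot all_order all_algebra.
From mathcomp Require Import generic_quotient.
From mathcomp Require Import all_classical all_reals all_analysis.
From mathcomp Require Import ring.
Import numFieldNormedType.Exports.

Set Implicit Arguments.
Unset Strict Implicit.
Unset Printing Implicit Defensive.
Import Order.TTheory GRing.Theory Num.Theory.

Local Open Scope classical_set_scope.
Local Open Scope ring_scope.
Local Open Scope quotient_scope.

(* Measurable types must be pointed and the simplex over X is inhabited only   *)
(* when X is, so nonemptiness of the input alphabet is carried by its type.    *)
HB.mixin Record isInhabited T := { inhabitedP : inhabited T }.
#[short(type="alphabetType")]
HB.structure Definition Alphabet := { T of Finite T & isInhabited T }.

Lemma card_alphabet_gt0 (X : alphabetType) : (0 < #|X|)%N.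
Proof. by have [x] := @inhabitedP X; apply/card_gt0P; exists x. Qed.

Section Channels.
Variable R : realType.

(* W x y stands for W(y|x) *)
Definition is_channel (X Y : finType) (W : {ffun X -> {ffun Y -> R}}) : bool :=
  [forall x, [forall y, 0 <= W x y <= 1] && (\sum_y W x y == 1)].

Record channel (X Y : finType) := Channel {
  channel_val :> {ffun X -> {ffun Y -> R}};
  channelP : is_channel channel_val }.

HB.instance Definition _ (X Y : finType) := [isSub for @channel_val X Y].
HB.instance Definition _ (X Y : finType) := [Choice of channel X Y by <:].

Lemma channel_ge0 (X Y : finType) (W : channel X Y) x y : 0 <= W x y.
Proof. by case: W => W /= /forallP/(_ x)/andP[/forallP/(_ y)/andP[]]. Qed.

Lemma channel_sum1 (X Y : finType) (W : channel X Y) x : \sum_y W x y = 1.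
Proof. by case: W => W /= /forallP/(_ x)/andP[_ /eqP]. Qed.

Lemma is_channelI (X Y : finType) (W : {ffun X -> {ffun Y -> R}}) :
  (forall x y, 0 <= W x y) -> (forall x, \sum_y W x y = 1) -> is_channel W.
Proof.
move=> W0 W1; apply/forallP => x; rewrite W1 eqxx andbT; apply/forallP => y.
by rewrite W0 -(W1 x) (bigD1 y)//= lerDl sumr_ge0.
Qed.

Definition channel_comp_fun (X Y Z : finType) (V : channel Y Z)
    (W : channel X Y) : {ffun X -> {ffun Z -> R}} :=
  [ffun x => [ffun z => \sum_y V y z * W x y]].

Lemma channel_comp_subproof (X Y Z : finType) (V : channel Y Z)
  (W : channel X Y) : is_channel (channel_comp_fun V W).
Proof.
apply: is_channelI => [x z|x].
  by rewrite !ffunE sumr_ge0// => y _; rewrite mulr_ge0// channel_ge0.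
under eq_bigr do rewrite !ffunE.
rewrite exchange_big/= -(channel_sum1 W x); apply: eq_bigr => y _.
by rewrite -mulr_suml channel_sum1 mul1r.
Qed.

Definition channel_comp (X Y Z : finType) (V : channel Y Z) (W : channel X Y) :
  channel X Z := Channel (channel_comp_subproof V W).

Definition degraded (X Y Z : finType) (W' : channel X Z) (W : channel X Y) :=
  exists V : channel Y Z, W' = channel_comp V W.

Definition equivalent (X Y Z : finType) (W : channel X Y) (W' : channel X Z) :=
  degraded W W' /\ degraded W' W.

Lemma degraded_refl (X Y : finType) (W : channel X Y) : degraded W W.
Proof.
have idP : is_channel [ffun y : Y => [ffun z : Y => (y == z)%:R : R]].
  apply: is_channelI => [y z|y]; first by rewrite !ffunE ler0n.
  rewrite (bigD1 y)//= !ffunE eqxx big1 ?addr0// => z zy.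
  by rewrite !ffunE eq_sym (negbTE zy).
exists (Channel idP); apply/val_inj/ffunP => x; apply/ffunP => z.
rewrite !ffunE (bigD1 z)//= !ffunE eqxx mul1r big1 ?addr0// => y yz.
by rewrite !ffunE (negbTE yz) mul0r.
Qed.

Lemma degraded_trans (X Y Z T : finType) (W : channel X Y) (W' : channel X Z)
  (W'' : channel X T) : degraded W' W -> degraded W'' W' -> degraded W'' W.
Proof.
move=> [V ->] [V' ->]; exists (channel_comp V' V).
apply/val_inj/ffunP => x; apply/ffunP => t; rewrite !ffunE.
under eq_bigr do rewrite !ffunE mulr_sumr.
under [RHS]eq_bigr do rewrite !ffunE mulr_suml.
rewrite exchange_big/=; apply: eq_bigr => y _; apply: eq_bigr => z _.
by rewrite mulrA.
Qed.

(* Disjoint union over the output alphabets {1, ..., m} with m >= 1, where    *)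
(* m = n.+1 and {1, ..., m} is represented by 'I_n.+1                          *)
Definition DMCstar (X : finType) := {n : nat & channel X 'I_n.+1}.

Definition equivalent_star (X : finType) (W W' : DMCstar X) : bool :=
  `[< equivalent (tagged W) (tagged W') >].

Lemma equivalent_star_refl (X : finType) : reflexive (@equivalent_star X).
Proof. by move=> W; apply/asboolP; split; apply: degraded_refl. Qed.

Lemma equivalent_star_sym (X : finType) : symmetric (@equivalent_star X).
Proof. by move=> W W'; apply/asboolP/asboolP => -[]. Qed.

Lemma equivalent_star_trans (X : finType) : transitive (@equivalent_star X).
Proof.
move=> W W' W'' /asboolP[a b] /asboolP[c d]; apply/asboolP.
by split; [exact: degraded_trans c a|exact: degraded_trans b d].
Qed.

Canonical equivalent_star_rel (X : finType) : equiv_rel (DMCstar X) :=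
  EquivRel (@equivalent_star X) (@equivalent_star_refl X)
    (@equivalent_star_sym X) (@equivalent_star_trans X).

End Channels.
Arguments DMCstar : clear implicits.

Definition DMCo (R : realType) (X : finType) : Type :=
  {eq_quot equivalent_star_rel R X}.
HB.instance Definition _ (R : realType) (X : finType) :=
  EqQuotient.copy (DMCo R X) {eq_quot equivalent_star_rel R X}.
HB.instance Definition _ (R : realType) (X : finType) :=
  Choice.copy (DMCo R X) {eq_quot equivalent_star_rel R X}.

Section Simplex.
Variables (R : realType) (X : alphabetType).

Definition simplex_set : set {ptws X -> R} :=
  [set p | (forall x, 0 <= p x) /\ \sum_x p x = 1].

(* set_type carries the subspace topology induced by {ptws X -> R}            *)
Definition simplex : Type := set_type simplex_set.
HB.instance Definition _ := Topological.copy simplex (set_type simplex_set).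
HB.instance Definition _ := SubType.copy simplex (set_type simplex_set).

Lemma card_alphabet_neq0 : #|X|%:R != 0 :> R.
Proof. by rewrite pnatr_eq0 -lt0n card_alphabet_gt0. Qed.

Lemma uniform_subproof : (fun=> #|X|%:R^-1 : R) \in simplex_set.
Proof.
apply/mem_set; split=> [x|]; first by rewrite invr_ge0.
by rewrite sumr_const -[LHS]mulr_natl mulfV// card_alphabet_neq0.
Qed.

Definition uniform_simplex : simplex :=
  exist (fun p => p \in simplex_set) _ uniform_subproof.
HB.instance Definition _ := isPointed.Build simplex uniform_simplex.

Definition borel_simplex := g_sigma_algebraType (@open simplex).
HB.instance Definition _ := Measurable.on borel_simplex.

End Simplex.
Arguments simplex_set : clear implicits.

Section Blackwell.
Variables (R : realType) (X : alphabetType).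

Definition output_prob (Y : finType) (W : channel R X Y) (y : Y) : R :=
  (\sum_x W x y) / #|X|%:R.

Definition image_channel (Y : finType) (W : channel R X Y) : {set Y} :=
  [set y | 0 < output_prob W y].

(* The default value is never used on image_channel W: see posteriorE. *)
Definition posterior (Y : finType) (W : channel R X Y) (y : Y) : simplex R X :=
  insubd (uniform_simplex R X) (fun x => W x y / (#|X|%:R * output_prob W y)).

Lemma output_prob_ge0 (Y : finType) (W : channel R X Y) y :
  0 <= output_prob W y.
Proof. by rewrite divr_ge0// sumr_ge0// => x _; apply: channel_ge0. Qed.

Lemma output_prob_sum1 (Y : finType) (W : channel R X Y) :
  \sum_y output_prob W y = 1.
Proof.
rewrite -mulr_suml exchange_big/=.
under eq_bigr do rewrite channel_sum1.
by rewrite sumr_const divff// card_alphabet_neq0.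
Qed.

Lemma output_probE (Y : finType) (W : channel R X Y) y :
  #|X|%:R * output_prob W y = \sum_x W x y.
Proof. by rewrite mulrC divfK// card_alphabet_neq0. Qed.

Lemma posteriorE (Y : finType) (W : channel R X Y) y :
  y \in image_channel W ->
  forall x, (val (posterior W y) : X -> R) x =
            W x y / (#|X|%:R * output_prob W y).
Proof.
rewrite inE => Wy x; rewrite val_insubd ifT//; apply/mem_set; split.
  by move=> x'; rewrite divr_ge0 ?channel_ge0// mulr_ge0// output_prob_ge0.
rewrite -mulr_suml output_probE divff// -output_probE.
by rewrite mulf_neq0 ?card_alphabet_neq0// gt_eqF.
Qed.

Lemma posteriorK (Y : finType) (W : channel R X Y) y x :
  (#|X|%:R * output_prob W y) * (val (posterior W y) : X -> R) x = W x y.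
Proof.
have [Wy|] := boolP (y \in image_channel W).
  rewrite posteriorE// mulrC divfK// mulf_neq0 ?card_alphabet_neq0//.
  by move: Wy; rewrite inE => /gt_eqF ->.
rewrite inE -leNgt => Wy; have W0 : output_prob W y = 0.
  by apply/le_anti; rewrite Wy output_prob_ge0.
rewrite W0 mulr0 mul0r; apply/esym/eqP.
have /eqP := output_probE W y; rewrite W0 mulr0 eq_sym psumr_eq0.
  by move=> /allP/(_ x); apply; rewrite mem_index_enum.
by move=> x' _; apply: channel_ge0.
Qed.

Section Measure.
Variables (Y : finType) (W : channel R X Y).
Local Open Scope ereal_scope.

Definition blackwell (B : set (borel_simplex R X)) : \bar R :=
  \sum_(y in image_channel W)
    (output_prob W y)%:E * \d_(posterior W y : borel_simplex R X) B.

Let blackwell0 : blackwell set0 = 0.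
Proof. by rewrite /blackwell big1// => y _; rewrite measure0 mule0. Qed.

Let blackwell_ge0 B : 0 <= blackwell B.
Proof.
by apply: sume_ge0 => y _; rewrite mule_ge0// lee_fin output_prob_ge0.
Qed.

Let blackwell_sigma_additive : semi_sigma_additive blackwell.
Proof.
move=> F mF tF mUF; rewrite [X in _ --> X](_ : _ =
    lim ((fun n => \sum_(0 <= i < n) blackwell (F i)) @ \oo)).
  by apply: is_cvg_ereal_nneg_natsum => k _; exact: blackwell_ge0.
rewrite nneseries_sum; last first.
  by move=> y k _; rewrite mule_ge0// lee_fin output_prob_ge0.
apply: eq_bigr => /= y _; rewrite nneseriesZl//.
by rewrite -measure_semi_bigcup.
Qed.

HB.instance Definition _ := isMeasure.Build _ _ _ blackwell
  blackwell0 blackwell_ge0 blackwell_sigma_additive.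

Lemma blackwell_fin (B : set (borel_simplex R X)) :
  blackwell B =
  (\sum_y output_prob W y * (posterior W y \in B)%:R)%R%:E.
Proof.
rewrite /blackwell -sumEFin big_mkcond/=; apply: eq_bigr => y _.
case: ifPn => [_|]; first by rewrite diracE EFinM.
rewrite inE -leNgt => Wy; have -> : output_prob W y = 0%R.
  by apply/le_anti; rewrite Wy output_prob_ge0.
by rewrite mul0r.
Qed.

Let blackwell_setT : blackwell setT = 1.
Proof.
rewrite blackwell_fin; congr (_%:E); rewrite -[RHS](output_prob_sum1 W).
by apply: eq_bigr => y _; rewrite in_setT/= mulr1.
Qed.

HB.instance Definition _ :=
  Measure_isProbability.Build _ _ _ blackwell blackwell_setT.

End Measure.

(* Equivalent channels have the same Blackwell measure: for W' = V o W the    *)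
(* squared deviations of the posteriors of W from those of W', weighted by V, *)
(* sum to energy W - energy W', which vanishes when W and W' are equivalent.  *)
Local Notation S W y := (#|X|%:R * output_prob W y).
Local Notation p W y := (val (posterior W y) : X -> R).

Let energy (Y : finType) (W : channel R X Y) : R :=
  \sum_y \sum_x S W y * p W y x ^+ 2.

Lemma output_prob_comp (Y Z : finType) (V : channel R Y Z) (W : channel R X Y)
  z : output_prob (channel_comp V W) z = \sum_y V y z * output_prob W y.
Proof.
rewrite /output_prob; under eq_bigr do rewrite !ffunE.
rewrite exchange_big/= mulr_suml; apply: eq_bigr => y _.
by rewrite -mulr_sumr mulrA.
Qed.

Lemma energy_comp (Y Z : finType) (V : channel R Y Z) (W : channel R X Y) :
  \sum_z \sum_y \sum_x V y z * S W y * (p W y x - p (channel_comp V W) z x) ^+ 2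
  = energy W - energy (channel_comp V W).
Proof.
pose W' := channel_comp V W.
have Szx z x : \sum_y V y z * S W y * (p W y x - p W' z x) ^+ 2 =
    (\sum_y V y z * S W y * p W y x ^+ 2) - S W' z * p W' z x ^+ 2.
  have e1 : \sum_y V y z * S W y * p W y x = S W' z * p W' z x.
    rewrite posteriorK !ffunE; apply: eq_bigr => y _.
    by rewrite -mulrA posteriorK.
  have e2 : \sum_y V y z * S W y = S W' z.
    rewrite output_prob_comp mulr_sumr; apply: eq_bigr => y _.
    by rewrite mulrCA.
  transitivity ((\sum_y V y z * S W y * p W y x ^+ 2) -
      2 * p W' z x * (\sum_y V y z * S W y * p W y x) +
      p W' z x ^+ 2 * (\sum_y V y z * S W y)).
    rewrite !mulr_sumr -sumrB -big_split/=; apply: eq_bigr => y _; ring.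
  by rewrite e1 e2; ring.
under eq_bigr do rewrite exchange_big/=.
under eq_bigr do under eq_bigr do rewrite Szx.
under eq_bigr do rewrite sumrB.
rewrite sumrB; congr (_ - _).
under eq_bigr do rewrite exchange_big/=.
rewrite exchange_big/=; apply: eq_bigr => y _; rewrite exchange_big/=.
apply: eq_bigr => x _.
by rewrite -mulr_suml -mulr_suml channel_sum1 mul1r.
Qed.

Lemma energy_comp_ge0 (Y Z : finType) (V : channel R Y Z) (W : channel R X Y)
  z y x :
  0 <= V y z * S W y * (p W y x - p (channel_comp V W) z x) ^+ 2.
Proof.
apply: mulr_ge0; last exact: sqr_ge0.
apply: mulr_ge0; first exact: channel_ge0.
by apply: mulr_ge0 => //; exact: output_prob_ge0.
Qed.

Lemma degraded_energy (Y Z : finType) (W : channel R X Y) (W' : channel R X Z) :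
  degraded W' W -> energy W' <= energy W.
Proof.
move=> [V ->]; rewrite -subr_ge0 -energy_comp.
by do 3 (apply: sumr_ge0 => ? _); exact: energy_comp_ge0.
Qed.

Lemma equivalent_blackwell (Y Z : finType) (W : channel R X Y)
    (W' : channel R X Z) :
  equivalent W W' -> blackwell W = blackwell W'.
Proof.
move=> [/degraded_energy + [V W'E]]; subst W'.
rewrite -subr_ge0 -opprB -energy_comp oppr_ge0 => le0.
have {le0} Vp z y : V y z * output_prob W y != 0 ->
    posterior W y = posterior (channel_comp V W) z.
  move=> Vzy; apply/val_inj/funext => x.
  have := le0; rewrite le_eqVlt ltNge; rewrite sumr_ge0 ?orbF; last first.
    by move=> ? _; do 2 (apply: sumr_ge0 => ? _); exact: energy_comp_ge0.
  rewrite psumr_eq0; last first.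
    by move=> ? _; do 2 (apply: sumr_ge0 => ? _); exact: energy_comp_ge0.
  move=> /allP/(_ z (mem_index_enum _))/=; rewrite psumr_eq0; last first.
    by move=> ? _; apply: sumr_ge0 => ? _; exact: energy_comp_ge0.
  move=> /allP/(_ y (mem_index_enum _))/=; rewrite psumr_eq0; last first.
    by move=> ? _; exact: energy_comp_ge0.
  move=> /allP/(_ x (mem_index_enum _))/=; rewrite 2!mulf_eq0 expf_eq0/= subr_eq0 mulf_eq0.
  move: Vzy; rewrite mulf_eq0 negb_or => /andP[/negbTE -> /negbTE ->].
  by rewrite (negbTE (card_alphabet_neq0 R X)) => /eqP.
apply/funext => B; rewrite !blackwell_fin; congr (_%:E).
transitivity (\sum_y \sum_z V y z * output_prob W y * (posterior W y \in B)%:R).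
  by apply: eq_bigr => y _; rewrite -!mulr_suml channel_sum1 mul1r.
rewrite exchange_big/=; apply: eq_bigr => z _.
rewrite output_prob_comp mulr_suml; apply: eq_bigr => y _.
have [->|/Vp ->//] := eqVneq (V y z * output_prob W y) 0.
by rewrite !mul0r.
Qed.

Lemma blackwell_set1 (Y : finType) (W : channel R X Y) (q : simplex R X) :
  blackwell W [set q] = (\sum_(y | posterior W y == q) output_prob W y)%:E.
Proof.
rewrite blackwell_fin [in RHS]big_mkcond/=; congr (_%:E).
apply: eq_bigr => y _.
by case: eqP => [->|yq]; [rewrite mem_set//= mulr1|rewrite memNset//= mulr0].
Qed.

Lemma blackwell_set1_degraded (Y Z : finType) (W : channel R X Y)
    (W' : channel R X Z) :
  (forall q, blackwell W [set q] = blackwell W' [set q]) -> degraded W' W.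
Proof.
move=> WW'.
pose m (q : simplex R X) := \sum_(z | posterior W' z == q) output_prob W' z.
have mE q : \sum_(y | posterior W y == q) output_prob W y = m q.
  by have := WW' q; rewrite !blackwell_set1 => -[].
have m0 q : 0 <= m q by apply: sumr_ge0 => z _; exact: output_prob_ge0.
pose V : {ffun Y -> {ffun Z -> R}} := [ffun y => [ffun z =>
  if m (posterior W y) == 0 then output_prob W' z else
  output_prob W' z * (posterior W' z == posterior W y)%:R / m (posterior W y)]].
have VP : is_channel V.
  apply: is_channelI => [y z|y].
    rewrite !ffunE; case: ifP => _; first exact: output_prob_ge0.
    by rewrite divr_ge0// mulr_ge0// output_prob_ge0.
  under eq_bigr do rewrite !ffunE.
  have [_|my] := eqVneq (m (posterior W y)) 0; first exact: output_prob_sum1.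
  rewrite -mulr_suml; under eq_bigr do rewrite mulr_natr mulrb.
  by rewrite -big_mkcond/= divff.
exists (Channel VP); apply/val_inj/ffunP => x; apply/ffunP => z.
rewrite !ffunE/= -posteriorK.
under [RHS]eq_bigr => y _ do rewrite -(posteriorK W y x) !ffunE.
have [z0|z0] := eqVneq (output_prob W' z) 0.
  rewrite z0 mulr0 mul0r big1// => y _.
  by case: ifP => _; rewrite !mul0r.
have mz : m (posterior W' z) != 0.
  rewrite gt_eqF// /m (bigD1 z)//= ltr_pwDl//; last first.
    by apply: sumr_ge0 => ? _; exact: output_prob_ge0.
  by rewrite lt_neqAle eq_sym z0 output_prob_ge0.
transitivity (\sum_(y | posterior W y == posterior W' z)
   output_prob W' z / m (posterior W' z) * (S W y * p W' z x)).
  rewrite -mulr_sumr -mulr_suml -mulr_sumr mE mulrAC mulrC.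
  by field.
rewrite big_mkcond/=; apply: eq_bigr => y _; case: ifPn => [/eqP yz|yz].
  by rewrite yz (negbTE mz) eqxx mulr1.
case: ifPn => [/eqP my|my]; last by rewrite eq_sym (negbTE yz) mulr0 !mul0r.
suff -> : output_prob W y = 0 by rewrite mulr0 mul0r mulr0.
apply/eqP; have /eqP := my; rewrite -mE psumr_eq0 => [/allP/(_ y)|? _].
  by rewrite mem_index_enum eqxx/=; apply.
exact: output_prob_ge0.
Qed.

Lemma blackwell_equivalent (Y Z : finType) (W : channel R X Y)
    (W' : channel R X Z) :
  (forall q, blackwell W [set q] = blackwell W' [set q]) -> equivalent W W'.
Proof.
by move=> WW'; split; apply: blackwell_set1_degraded => // q; rewrite WW'.
Qed.

End Blackwell.

Section TotalVariation.
Context d (T : measurableType d) (R : realType).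

Definition tv_dist (mu nu : probability T R) : R :=
  sup [set `|fine (mu B) - fine (nu B)| | B in d.-measurable].

Let tv_has_sup (mu nu : probability T R) :
  has_sup [set `|fine (mu B) - fine (nu B)| | B in d.-measurable].
Proof.
split; first by eexists; exists set0 => //; exact: measurable0.
exists 2 => _ [B mB <-]; rewrite (le_trans (ler_normB _ _))// (natrD _ 1 1).
by rewrite lerD// ger0_norm ?fine_ge0// -lee_fin fineK ?fin_num_measure//;
  exact: probability_le1.
Qed.

Lemma tv_dist_ub (mu nu : probability T R) B : measurable B ->
  `|fine (mu B) - fine (nu B)| <= tv_dist mu nu.
Proof. by move=> mB; apply: sup_upper_bound => //; exists B. Qed.

Lemma tv_dist_le (mu nu : probability T R) c :
  (forall B, measurable B -> `|fine (mu B) - fine (nu B)| <= c) ->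
  tv_dist mu nu <= c.
Proof.
move=> h; apply: ge_sup; first by case: (tv_has_sup mu nu).
by move=> _ [B mB <-]; exact: h.
Qed.

Lemma tv_distxx (mu : probability T R) : tv_dist mu mu = 0.
Proof.
apply/le_anti/andP; split; first by apply: tv_dist_le => B _; rewrite subrr normr0.
exact: le_trans (normr_ge0 _) (tv_dist_ub mu mu measurable0).
Qed.

Lemma tv_dist_sym (mu nu : probability T R) : tv_dist mu nu = tv_dist nu mu.
Proof.
by apply/le_anti/andP; split; apply: tv_dist_le => B mB; rewrite distrC tv_dist_ub.
Qed.

Lemma tv_dist_triangle (nu mu xi : probability T R) :
  tv_dist mu xi <= tv_dist mu nu + tv_dist nu xi.
Proof.
apply: tv_dist_le => B mB; rewrite (le_trans (ler_distD (fine (nu B)) _ _))//.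
by rewrite lerD// tv_dist_ub.
Qed.

Lemma tv_dist_eq0 (mu nu : probability T R) : tv_dist mu nu = 0 ->
  forall B, measurable B -> mu B = nu B.
Proof.
move=> mn0 B mB; have := tv_dist_ub mu nu mB.
rewrite mn0 normr_le0 subr_eq0 => /eqP h.
by rewrite -(fineK (fin_num_measure mu B mB)) h fineK// fin_num_measure.
Qed.

End TotalVariation.

Section DMCoMetric.
Variables (R : realType) (X : alphabetType).

(* Independent of the channel picked by repr: see blackwell_DMCo_pi           *)
Definition blackwell_DMCo (q : DMCo R X) :
  probability (borel_simplex R X) R := blackwell (tagged (repr q)).

Lemma blackwell_DMCo_pi (W : DMCstar R X) (B : set (borel_simplex R X)) :
  blackwell_DMCo (\pi_(DMCo R X) W) B = blackwell (tagged W) B.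
Proof.
rewrite /blackwell_DMCo/=; congr (_ B); apply: equivalent_blackwell.
suff /asboolP : equivalent_star (repr (\pi_(DMCo R X) W)) W by [].
by rewrite -(@pi_eq_quot _ _ (DMCo R X)) reprK.
Qed.

Lemma measurable_simplex1 (q : borel_simplex R X) : measurable [set q].
Proof.
rewrite -[X in measurable X]setCK; apply: measurableC.
apply: sub_sigma_algebra; apply: closed_openC.
have -> : [set q] = (@set_val _ (simplex_set R X)) @^-1`
    [set (set_val q : {ptws X -> R})].
  by apply/seteqP; split=> [_ -> //|q' /= /val_inj].
apply: closed_comp => [? _|]; first exact: initial_continuous.
apply: accessible_closed_set1; apply: hausdorff_accessible.
by apply: hausdorff_product => x; exact: Rhausdorff.
Qed.

Definition tv_DMCo (q q' : DMCo R X) : R :=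
  tv_dist (blackwell_DMCo q) (blackwell_DMCo q').

Let tv_DMCo_positivity q q' : tv_DMCo q q' = 0 -> q = q'.
Proof.
move=> /tv_dist_eq0 h; rewrite -[q]reprK -[q']reprK; apply/eqP.
rewrite pi_eq_quot; apply/asboolP; apply: blackwell_equivalent => p.
by apply: h; exact: measurable_simplex1.
Qed.

HB.instance Definition _ := isMetric.Build R (DMCo R X)
  (fun q => tv_distxx (blackwell_DMCo q)) tv_DMCo_positivity
  (fun q q' => tv_dist_sym (blackwell_DMCo q) (blackwell_DMCo q'))
  (fun q q' q'' => tv_dist_triangle (blackwell_DMCo q) (blackwell_DMCo q')
     (blackwell_DMCo q'')).

Lemma mdist_DMCoE (q q' : DMCo R X) : mdist q q' = tv_DMCo q q'.
Proof. by []. Qed.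

End DMCoMetric.

Definition baire_space (T : topologicalType) :=
  forall U : (set T)^nat, (forall n, open (U n) /\ dense (U n)) ->
    dense (\bigcap_n U n).

(* Main.v *)
(* There are pairwise distinct points p_0, p_1, ... of the simplex and binary  *)
(* channels V_n whose Blackwell measures give p_n a mass at least c > 0, with  *)
(* c independent of n.  Mixing a class q with V_n in proportions 1 - e : e     *)
(* moves it by at most e in total variation and creates mass at least e c at   *)
(* p_n, whereas each single class charges only finitely many p_n.             *)
(* Hence the open sets of classes charging some p_k with k >= n are dense with *)
(* empty intersection, and in a compact neighbourhood of q the mixtures with   *)
(* V_0, V_1, ... would have a cluster point r, which is impossible because r   *)
(* is at distance at least e c from all but finitely many of them.            *)
Require Import Defs.
From HB Require Import structures.
From mathcomp Require Import all_boot all_order all_algebra.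
From mathcomp Require Import all_classical all_reals all_analysis.
From mathcomp Require Import ring lra.
Import Order.TTheory GRing.Theory Num.Theory.
Import numFieldNormedType.Exports.

Local Open Scope classical_set_scope.
Local Open Scope ring_scope.

(** Singletons are Borel, so the mass at a point is a 1-Lipschitz function of the class. By
    [spread_atoms] and [mix_ball], every ball contains for each [n] a class whose mass at [p n]
    exceeds a positive bound independent of [n]; by [mass_set1_near0], a single class charges only
    finitely many [p n]. [DMCo_not_baire] and [DMCo_nbhs_not_compact] both exploit this clash. *)

Section Perturbation.
Variables (R : realType) (X : alphabetType).

Local Notation mass W B := (fine (blackwell W B)).
Local Notation massq q B := (fine (blackwell_DMCo q B)).

Lemma mass_itv01 (Y : finType) (W : channel R X Y) B :
  measurable B -> 0 <= mass W B <= 1.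
Proof.
move=> mB; rewrite fine_ge0 ?measure_ge0//= -lee_fin fineK ?fin_num_measure//.
exact: probability_le1.
Qed.

(** Normalisation cancels [a]; a null column leads to the same default on both sides. *)
Lemma posterior_congr (Y Z : finType) (W : channel R X Y) (V : channel R X Z)
    (y : Y) (z : Z) (a : R) :
  a != 0 -> (forall x, V x z = a * W x y) -> posterior V z = posterior W y.
Proof.
move=> a0 VW; congr (insubd _ _); apply/funext => x.
have -> : output_prob V z = a * output_prob W y.
  by rewrite /output_prob mulrA mulr_sumr; congr (_ / _); apply: eq_bigr.
by rewrite VW mulrCA -mulf_div divff// mul1r.
Qed.

(** On the disjoint union of the outputs, scaling the columns by [1 - e] and [e] keeps their
    posteriors and scales their output probabilities. *)
Lemma mix_channel (m n : nat) (W : channel R X 'I_m) (V : channel R X 'I_n)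
    (e : R) : 0 < e < 1 ->
  exists U : channel R X 'I_(m + n), forall B,
    mass U B = (1 - e) * mass W B + e * mass V B.
Proof.
move=> /andP[e0 e1]; have e1' : 0 < 1 - e by rewrite subr_gt0.
pose u : {ffun X -> {ffun 'I_(m + n) -> R}} := [ffun x => [ffun i =>
  match fintype.split i with inl j => (1 - e) * W x j | inr j => e * V x j end]].
have ul (x : X) (j : 'I_m) : u x (lshift n j) = (1 - e) * W x j.
  by rewrite !ffunE (unsplitK (inl j)).
have ur (x : X) (j : 'I_n) : u x (rshift m j) = e * V x j.
  by rewrite !ffunE (unsplitK (inr j)).
have uP : is_channel u.
  apply: is_channelI => [x i|x].
    by rewrite !ffunE; case: fintype.split => j;
      rewrite mulr_ge0 ?channel_ge0// ltW.
  rewrite big_split_ord/=; under eq_bigr do rewrite ul.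
  under [X in _ + X]eq_bigr do rewrite ur.
  by rewrite -!mulr_sumr !channel_sum1 !mulr1 subrK.
exists (Channel uP) => B; rewrite !blackwell_fin/= big_split_ord/= !mulr_sumr.
congr (_ + _); apply: eq_bigr => j _.
  rewrite (@posterior_congr _ _ W _ j _ (1 - e)) ?gt_eqF// mulrA.
  congr (_ * _); rewrite /output_prob mulrA mulr_sumr; congr (_ / _).
  by apply: eq_bigr => x _; rewrite ul.
rewrite (@posterior_congr _ _ V _ j _ e) ?gt_eqF// mulrA.
congr (_ * _); rewrite /output_prob mulrA mulr_sumr; congr (_ / _).
by apply: eq_bigr => x _; rewrite ur.
Qed.

Lemma mix_DMCo (n : nat) (q : DMCo R X) (V : channel R X 'I_n) (e : R) :
  0 < e < 1 -> exists q' : DMCo R X, forall B,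
    massq q' B = (1 - e) * massq q B + e * mass V B.
Proof.
move=> e01; have [U UE] := mix_channel _ _ (tagged (repr q)) V _ e01.
(* The first alphabet has successor size, so the sum is convertible to a successor, as [DMCstar]
   requires. *)
exists (\pi_(DMCo R X)%qT
  (Tagged (fun k => channel R X 'I_k.+1) (U : channel R X 'I_(_ + n).+1))).
by move=> B; rewrite blackwell_DMCo_pi -UE.
Qed.

(** The weight [e] is chosen before [V], so one lower bound serves a whole sequence of channels. *)
Lemma mix_ball (q : DMCo R X) (d : R) : 0 < d ->
  exists2 e, 0 < e & forall n (V : channel R X 'I_n),
    exists2 q' : DMCo R X, ball q d q' &
      forall B, measurable B -> e * mass V B <= massq q' B.
Proof.
move=> d0; pose e : R := Num.min (d / 2) (2^-1).
have e0 : 0 < e by rewrite lt_min divr_gt0//= invr_gt0.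
have ed : e < d by rewrite /e gt_min ltr_pdivrMr// ltr_pMr// ltr1n.
have e1 : e < 1 by rewrite /e gt_min invf_lt1// ltr1n orbT.
have e01 : 0 < e < 1 by rewrite e0.
exists e => // n V; have [q' q'E] := mix_DMCo n q V e e01.
exists q' => [|B mB].
  rewrite ballEmdist/= mdist_DMCoE; apply: le_lt_trans ed.
  apply: tv_dist_le => B mB; rewrite q'E.
  have /andP[a0 a1] := mass_itv01 _ (tagged (repr q)) B mB.
  have /andP[b0 b1] := mass_itv01 _ V B mB.
  rewrite -/(blackwell_DMCo q) in a0 a1.
  rewrite (_ : _ - _ = e * (massq q B - mass V B)); last by ring.
  rewrite normrM gtr0_norm// ler_piMr ?(ltW e0)// ler_norml.
  by apply/andP; split; lra.
rewrite q'E lerDr mulr_ge0 ?subr_ge0 ?(ltW e1)//.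
by have /andP[] := mass_itv01 _ (tagged (repr q)) B mB.
Qed.

(** Each of the finitely many posteriors equals at most one [p k]. *)
Lemma mass_set1_near0 (Y : finType) (W : channel R X Y)
    (p : nat -> simplex R X) : injective p ->
  \forall n \near \oo, mass W [set p n] = 0.
Proof.
move=> pI; have : \forall n \near \oo, forall y, posterior W y != p n.
  apply: filter_forall => y.
  have [[k pk]|npk] := pselect (exists k, p k = posterior W y).
    exists k.+1 => // n /= kn; apply/eqP; rewrite -pk => /pI nk.
    by rewrite nk ltnn in kn.
  by apply: nearW => n; apply/eqP => yn; apply: npk; exists n.
apply: filterS => n pn; rewrite blackwell_set1 big_pred0// => y.
exact/negbTE.
Qed.

(* p n has coordinates in the ratio 1/(n+2) : 1/2 at two fixed inputs, hence  *)
(* the p n are pairwise distinct; c = 1/(2|X|).                               *)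
Lemma spread_atoms : (2 <= #|X|)%N ->
  exists (p : nat -> simplex R X) (c : R), [/\ injective p, 0 < c &
    forall n, exists V : channel R X 'I_2, c <= mass V [set p n]].
Proof.
move=> /card_gt1P[x0 [x1 [_ _ x01]]].
pose a n x : R := if x == x0 then n.+2%:R^-1 else 2^-1.
have a0 n x : 0 <= a n x by rewrite /a; case: ifP.
have a1 n x : a n x <= 1.
  by rewrite /a; case: ifP => _; rewrite invf_le1// ler1n.
pose v n : {ffun X -> {ffun 'I_2 -> R}} :=
  [ffun x => [ffun i => if i == ord0 then a n x else 1 - a n x]].
have vP n : is_channel (v n).
  apply: is_channelI => [x i|x].
    by rewrite !ffunE; case: ifP => // _; rewrite subr_ge0.
  by rewrite big_ord_recl big_ord1 !ffunE/= addrC subrK.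
pose V n := Channel (vP n).
have V0 n x : V n x ord0 = a n x by rewrite !ffunE.
exists (fun n => posterior (V n) ord0), (2^-1 / #|X|%:R); split.
- move=> m n mn.
  have := posteriorK (V m) ord0 x1; have := posteriorK (V n) ord0 x1.
  have := posteriorK (V m) ord0 x0; have := posteriorK (V n) ord0 x0.
  rewrite !V0 /a eqxx eq_sym (negbTE x01) mn.
  set s := _ * output_prob (V n) _; set t := _ * output_prob (V m) _.
  set P := (val _ : X -> R) => sn tm s1 t1.
  have P1 : P x1 != 0.
    by apply: contra_eq_neq s1 => ->; rewrite mulr0 eq_sym invr_eq0 pnatr_eq0.
  (* The columns are [s] and [t] times the same [P]: the entry 1/2 at [x1] forces [s = t], then [x0]
     gives [m = n]. *)
  have st : s = t by apply: (mulIf P1); rewrite s1 t1.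
  have /invr_inj/eqP : m.+2%:R^-1 = n.+2%:R^-1 :> R by rewrite -sn -tm st.
  by rewrite eqr_nat => /eqP[].
- by rewrite divr_gt0// ltr0n card_alphabet_gt0.
- move=> n; exists (V n); rewrite blackwell_set1/= (bigD1 ord0)//=.
  (* Only an inequality: the other output may share this posterior. *)
  apply: (@le_trans _ _ (output_prob (V n) ord0)); last first.
    by rewrite lerDl sumr_ge0// => i _; exact: output_prob_ge0.
  rewrite ler_pM2r ?invr_gt0 ?ltr0n ?card_alphabet_gt0//.
  rewrite (bigD1 x1)// V0 /a eq_sym (negbTE x01) lerDl sumr_ge0// => x _.
  exact: channel_ge0.
Qed.

Lemma DMCo_nbhs_not_compact (q : DMCo R X) (K : set (DMCo R X)) :
  (2 <= #|X|)%N -> nbhs q K -> ~ compact K.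
Proof.
move=> /spread_atoms[p [c [pI c0 Vc]]] /nbhs_ballP[d /= d0 dK] Kc.
have [e e0 mixV] := mix_ball q d d0.
have /choice[s sP] n : exists q', ball q d q' /\
    e * c <= massq q' [set p n].
  have [V cV] := Vc n; have [q' qq' q'V] := mixV _ V.
  exists q'; split=> //; apply: le_trans (q'V _ (measurable_simplex1 _)).
  by rewrite ler_pM2l.
have sK n : K (s n) by apply: dK; have [] := sP n.
have [r [_ rs]] : K `&` cluster (s @ \oo) !=set0.
  by apply: Kc; exists 0%N => // n _; exact: sK.
have [r0 _ rN] := mass_set1_near0 _ (tagged (repr r)) p pI.
have ec0 : 0 < e * c by rewrite mulr_gt0.
(* A tail of [s] would have to meet this ball around [r]. *)
have [] := rs (s @` [set n | (r0 <= n)%N]) (ball r (e * c)).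
- by exists r0 => // n /= rn; exists n.
- exact: nbhsx_ballx.
move=> _ [[n /= rn <-]]; rewrite ballEmdist/= mdist_DMCoE ltNge => /negP; apply.
apply: le_trans (tv_dist_ub _ _ (measurable_simplex1 (p n))).
rewrite /blackwell_DMCo rN//= sub0r normrN.
by apply: le_trans (ler_norm _); have [] := sP n.
Qed.

Lemma DMCo_not_baire : (2 <= #|X|)%N -> ~ baire_space (DMCo R X).
Proof.
move=> /spread_atoms[p [c [pI c0 Vc]]] baire.
pose U n := [set q : DMCo R X |
  exists2 k, (n <= k)%N & 0 < massq q [set p k]].
have /baire UD : forall n, open (U n) /\ dense (U n).
  move=> n; split.
    rewrite openE => q [k nk qk]; apply/nbhs_ballP.
    (* Within this radius the mass at [p k] drops by less than its value. *)
    exists (massq q [set p k]) => // r; rewrite ballEmdist/= mdist_DMCoE => qr; exists k => //.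
    have := tv_dist_ub (blackwell_DMCo q) (blackwell_DMCo r)
      (measurable_simplex1 (p k)).
    move=> /(le_trans (ler_norm _)).
    move: qr; rewrite /tv_DMCo; set t := tv_dist _ _; lra.
  move=> O [q Oq] oO.
  have /nbhs_ballP[d /= d0 dO] := open_nbhs_nbhs (conj oO Oq).
  have [e e0 mixV] := mix_ball q d d0.
  have [V cV] := Vc n; have [q' qq' q'V] := mixV _ V.
  exists q'; split; first exact: dO.
  exists n => //; apply: lt_le_trans (q'V _ (measurable_simplex1 _)).
  by rewrite mulr_gt0// (lt_le_trans c0).
(* Density needs a nonempty open set; any [V] shows that the whole space is one. *)
have [|q [_ qU]] := UD setT _ openT.
  have [V _] := Vc 0%N.
  by exists (\pi_(DMCo R X)%qT
    (Tagged (fun k => channel R X 'I_k.+1) (V : channel R X 'I_1.+1))).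
have [N _ qN] := mass_set1_near0 _ (tagged (repr q)) p pI.
by have [k Nk] := qU N I; rewrite /blackwell_DMCo qN//= ltxx.
Qed.

End Perturbation.

Theorem proposition16 (R : realType) (X : alphabetType) (hX : (2 <= #|X|)%N) :
  ~ baire_space (DMCo R X) /\
  (forall q : DMCo R X, ~ exists K : set (DMCo R X), nbhs q K /\ compact K).
Proof.
split; first exact: DMCo_not_baire.
by move=> q [K [qK]]; exact: DMCo_nbhs_not_compact hX qK.
Qed.
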